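(* Let $n$ and $k$ be positive integers, let $V=\mathbb{C}^n$ be the natural representation of the symmetric inverse semigroup $\mathcal{IS}_n$, let $\mathcal{IS}_n$ act diagonally on $V^{\otimes k}$, and let the dual symmetric inverse semigroup $\mathcal{I}^*_k$ act (from the right) on $V^{\otimes k}$ as described in the context. Then: (i) The actions of $\mathcal{IS}_n$ and $\mathcal{I}^*_k$ on $V^{\otimes k}$ commute. (ii) $\mathrm{End}_{\mathcal{IS}_n}(V^{\otimes k})$ coincides with the image of $\mathbb{C}[\mathcal{I}^*_k]$ in $\mathrm{End}_{\mathbb{C}}(V^{\otimes k})$. (iii) $\mathrm{End}_{\mathcal{I}^*_k}(V^{\otimes k})$ coincides with the image of $\mathbb{C}[\mathcal{IS}_n]$ in $\mathrm{End}_{\mathbb{C}}(V^{\otimes k})$. (iv) The representation of $\mathcal{IS}_n$ on $V^{\otimes k}$ is faithful. (v) The representation of $\mathcal{I}^*_k$ on $V^{\otimes k}$ is faithful if and only if $n\geq 2$ or $k=1$. (vi) The representation of $\overline{\mathbb{C}[\mathcal{IS}_n]}$ on $V^{\otimes k}$ is faithful if and only if $k\geq n$. (vii) The representation of $\mathbb{C}[\mathcal{I}^*_k]$ on $V^{\otimes k}$ is faithful if and only if $k\leq n$.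
   Context: General notation. $n,k$ are fixed positive integers; $\mathbf{N}=\{1,\dots,n\}$, $\mathbf{K}=\{1,\dots,k\}$, $\mathbf{K}'=\{1',\dots,k'\}$ (a disjoint copy of $\mathbf{K}$), $\tilde{\mathbf{K}}=\mathbf{K}\cup\mathbf{K}'$. For a semigroup $S$, $\mathbb{C}[S]$ is the semigroup algebra over $\mathbb{C}$; if $S$ has a zero element $0$, then $\overline{\mathbb{C}[S]}=\mathbb{C}[S]/(0)$ is the contracted semigroup algebra, i.e. the quotient by the one-dimensional ideal spanned by the zero element of $S$. A representation of a semigroup or of an algebra is faithful if the corresponding map to the linear operators is injective. For a semigroup $S$ acting linearly on $W$, $\mathrm{End}_S(W)$ is the algebra of linear operators on $W$ commuting with the action of every element of $S$. The semigroup $\mathcal{IS}_n$. It is the semigroup of all partial injective maps $\mathbf{N}\to\mathbf{N}$ (injective maps $A\to\mathbf{N}$ with $A\subset\mathbf{N}$), under composition of partial maps (composed from right to left). Its zero element is the nowhere defined map $\varepsilon_{\varnothing}$. On $V=\mathbb{C}^n$ with standard basis $e_1,\dots,e_n$ the natural representation is: $\pi e_i=e_{\pi(i)}$ if $i$ is in the domain of $\pi$, and $\pi e_i=0$ otherwise. The diagonal action on $V^{\otimes k}$ is $\pi(x_1\otimes\dots\otimes x_k)=\pi x_1\otimes\dots\otimes\pi x_k$. The zero element $\varepsilon_\varnothing$ acts on $V^{\otimes k}$ as $0$, so $V^{\otimes k}$ is also a module over $\overline{\mathbb{C}[\mathcal{IS}_n]}$. The semigroup $\mathcal{I}^*_k$.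 Its elements are all partitions of $\tilde{\mathbf{K}}$ into disjoint nonempty subsets (blocks) such that each block intersects both $\mathbf{K}$ and $\mathbf{K}'$ non-trivially. Product $\alpha\beta$: identify each element $j'$ of $\mathbf{K}'$ for $\alpha$ with the element $j$ of $\mathbf{K}$ for $\beta$ (so that there are three copies of $\mathbf{K}$: the unprimed elements of $\alpha$, the middle elements, and the primed elements of $\beta$), take the finest partition of the union of the three copies for which every block of $\alpha$ and every block of $\beta$ is contained in a single part, and restrict this partition to the unprimed elements of $\alpha$ together with the primed elements of $\beta$; this restriction is $\alpha\beta$. Action of $\mathcal{I}^*_k$ on $V^{\otimes k}$. For $\mathbf{i}=(i_1,\dots,i_k)\in\mathbf{N}^k$ put $v_{\mathbf{i}}=e_{i_1}\otimes\dots\otimes e_{i_k}$; these vectors form a basis of $V^{\otimes k}$. For $\alpha\in\mathcal{I}^*_k$ let $M(\alpha,\mathbf{i})$ be the set of all $\mathbf{l}=(l_1,\dots,l_k)\in\mathbf{N}^k$ such that for each block $\{a_1,\dots,a_p,b_1',\dots,b_q'\}$ of $\alpha$ (with $a_s,b_t\in\mathbf{K}$) one has $i_{a_1}=\dots=i_{a_p}=l_{b_1}=\dots=l_{b_q}$ (this set has at most one element). Then $\alpha$ acts as the unique linear operator with $\alpha(v_{\mathbf{i}})=\sum_{\mathbf{l}\in M(\alpha,\mathbf{i})}v_{\mathbf{l}}$ (which is $0$ if $M(\alpha,\mathbf{i})=\varnothing$). This defines a right action: the operator of $\alpha\beta$ is obtained by applying first the operator of $\alpha$ and then that of $\beta$.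 The image of $\mathbb{C}[\mathcal{I}^*_k]$ is the linear span of these operators. *)

(* Defs.v *)
From HB Require Import structures.
From mathcomp Require Import all_boot all_order all_algebra.
From mathcomp Require Import reals complex.

Set Implicit Arguments.
Unset Strict Implicit.
Unset Printing Implicit Defensive.

Import GRing.Theory.

#[short(type="finSemigroupType")]
HB.structure Definition FinSemigroup := {S of Semigroup S & Finite S}.

Definition partial_inj (n : nat) (f : {ffun 'I_n -> option 'I_n}) : bool :=
  [forall i, forall j, (f i == f j) && (f i != None) ==> (i == j)].

Record IS (n : nat) := MkIS {
  is_fun :> {ffun 'I_n -> option 'I_n};
  is_funP : partial_inj is_fun }.

HB.instance Definition _ n := [isSub for @is_fun n].
HB.instance Definition _ n := [Finite of IS n by <:].

Section SymInv.
Variable n : nat.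
Implicit Types p q r : IS n.

Lemma is_inj p i j u : p i = Some u -> p j = Some u -> i = j.
Proof.
move=> pi pj; have /forallP/(_ i)/forallP/(_ j) := is_funP p.
by rewrite pi pj eqxx => /eqP.
Qed.

(* Right-to-left composition: [q] is applied first. *)
Definition pcomp_fun p q : {ffun 'I_n -> option 'I_n} :=
  [ffun i => obind p (q i)].

Lemma pcomp_inj p q : partial_inj (pcomp_fun p q).
Proof.
apply/forallP => i; apply/forallP => j; rewrite !ffunE.
apply/implyP => /andP[/eqP]; case qi: (q i) => [u|] //=.
case pu: (p u) => [w|] //; case qj: (q j) => [v|] //= pv _.
by apply/eqP; apply: is_inj qi _; rewrite qj (is_inj pu (esym pv)).
Qed.

Definition pcomp p q : IS n := MkIS (pcomp_inj p q).

HB.instance Definition _ := hasMul.Build (IS n) pcomp.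

Lemma pcompE p q i : (p * q)%g i = obind p (q i).
Proof. by rewrite ffunE. Qed.

Lemma pcompA : associative (@monoid.mul (IS n)).
Proof.
by move=> p q r; apply/val_inj/ffunP => i; rewrite !pcompE; case: (r i) => //= u; rewrite pcompE.
Qed.

HB.instance Definition _ := Magma_isSemigroup.Build (IS n) pcompA.

Lemma empty_inj : partial_inj [ffun _ : 'I_n => None].
Proof. by apply/forallP => i; apply/forallP => j; rewrite !ffunE. Qed.

Definition is_empty : IS n := MkIS empty_inj.

Lemma is_emptyE i : is_empty i = None. Proof. by rewrite ffunE. Qed.

Lemma is_empty_zero p : (p * is_empty = is_empty)%g /\ (is_empty * p = is_empty)%g.
Proof.
split; apply/val_inj/ffunP => i; rewrite pcompE is_emptyE //.
by case: (p i) => //= u; rewrite is_emptyE.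
Qed.

End SymInv.

HB.instance Definition _ n := FinSemigroup.on (IS n).

(* [inl a] stands for [a] in K and [inr b] for [b'] in K'. *)
Definition Ktilde (k : nat) : finType := ('I_k + 'I_k)%type.

Definition dual_part (k : nat) (P : {set {set Ktilde k}}) : bool :=
  partition P setT &&
  [forall B in P, [exists a, inl a \in B] && [exists b, inr b \in B]].

Record DIS (k : nat) := MkDIS {
  blocks :> {set {set Ktilde k}};
  blocksP : dual_part blocks }.

HB.instance Definition _ k := [isSub for @blocks k].
HB.instance Definition _ k := [Finite of DIS k by <:].

Definition compatible (k : nat) (X : eqType) (P : {set {set Ktilde k}})
    (c : Ktilde k -> X) : bool :=
  [forall B in P, forall x in B, forall y in B, c x == c y].

Definition glue_lab (k : nat) (X : Type) (f g : 'I_k -> X) (x : Ktilde k) : X :=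
  match x with inl a => f a | inr b => g b end.

Section DualSymInv.
Variable k : nat.
Implicit Types a b c : DIS k.

(* Three copies of K: [inl (inl _)] are the unprimed elements of the left
   factor, [inl (inr _)] the identified middle elements, [inr _] the primed
   elements of the right factor. *)
Definition Ktriple : finType := ('I_k + 'I_k + 'I_k)%type.

Definition in_left (x : Ktilde k) : Ktriple := inl x.
Definition in_right (x : Ktilde k) : Ktriple :=
  match x with inl j => inl (inr j) | inr j => inr j end.
Definition in_outer (x : Ktilde k) : Ktriple :=
  match x with inl j => inl (inl j) | inr j => inr j end.

Definition stacked a b : {set {set Ktriple}} :=
  [set in_left @: B | B : {set Ktilde k} in blocks a] :|:
  [set in_right @: B | B : {set Ktilde k} in blocks b].

Definition share_block a b : rel Ktriple :=
  [rel u v | [exists B in stacked a b, (u \in B) && (v \in B)]].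

(* The connected components of [share_block]; see [stack_part_finest]. *)
Definition stack_part a b : {set {set Ktriple}} :=
  equivalence_partition (connect (share_block a b)) setT.

Definition dprod_set a b : {set {set Ktilde k}} :=
  [set in_outer @^-1: B | B : {set Ktriple} in stack_part a b].

Lemma share_sym a b : connect_sym (share_block a b).
Proof.
apply: sym_connect_sym => u v.
by apply: eq_existsb => B; rewrite [X in _ && X]andbC.
Qed.

Lemma connect_equiv a b :
  {in setT & &, equivalence_rel (connect (share_block a b))}.
Proof.
move=> x y z _ _ _; split; first exact: connect0.
by move=> xy; rewrite (same_connect (share_sym a b) xy).
Qed.

Lemma stack_partP a b : partition (stack_part a b) setT.
Proof. exact: equivalence_partitionP (@connect_equiv a b). Qed.

Lemma mem_stack_part a b u v :
  (v \in pblock (stack_part a b) u) = connect (share_block a b) u v.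
Proof. by rewrite pblock_equivalence_partition //; exact: connect_equiv. Qed.

(* [stack_part a b] is the finest partition in which every block of either
   factor lies in a single part. *)
Lemma stack_part_finest a b :
  (forall B, B \in stacked a b ->
     exists2 D, D \in stack_part a b & B \subset D) /\
  (forall Q : {set {set Ktriple}}, partition Q setT ->
     (forall B, B \in stacked a b -> exists2 D, D \in Q & B \subset D) ->
     forall D, D \in stack_part a b -> exists2 E, E \in Q & D \subset E).
Proof.
have [covP trivP nP] := and3P (stack_partP a b).
have cov u : u \in cover (stack_part a b) by rewrite (eqP covP) inE.
split=> [B BP | Q Qpart QB D DP].
  have [u uB] : exists u, u \in B.
    have nonempty c (C : {set Ktilde k}) : C \in blocks c -> exists x, x \in C.
      move=> Cc; have /andP[/and3P[_ _ n0] _] := blocksP c.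
      by apply/set0Pn; apply: contraNneq n0 => <-.
    case/setUP: BP => /imsetP[C CP ->]; have [x xC] := nonempty _ _ CP.
      by exists (in_left x); apply: imset_f.
    by exists (in_right x); apply: imset_f.
  exists (pblock (stack_part a b) u); first exact: pblock_mem.
  apply/subsetP => v vB; rewrite mem_stack_part; apply: connect1.
  by apply/exists_inP; exists B; rewrite ?uB.
have [covQ trivQ nQ] := and3P Qpart.
have [u uD] : exists u, u \in D.
  by apply/set0Pn; apply: contraNneq nP => <-.
have covu v : v \in cover Q by rewrite (eqP covQ) inE.
exists (pblock Q u); first exact: pblock_mem.
apply/subsetP => v vD.
have : connect (share_block a b) u v.
  by rewrite -mem_stack_part (def_pblock trivP DP uD).
rewrite -eq_pblock //; set e := share_block a b => uv.
have cl : closed e [pred w | pblock Q u == pblock Q w].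
  apply: intro_closed; first exact: share_sym.
  move=> x y /exists_inP[B BP /andP[xB yB]] /=; rewrite !inE => /eqP ->.
  have [E EQ BE] := QB B BP.
  by rewrite !(def_pblock trivQ EQ) ?(subsetP BE).
by have := closed_connect cl uv; rewrite !inE eqxx => <-.
Qed.

Lemma share_left a b B x y :
  B \in blocks a -> x \in B -> y \in B ->
  connect (share_block a b) (in_left x) (in_left y).
Proof.
move=> Ba xB yB; apply/connect1/exists_inP; exists (in_left @: B).
  by apply/setUP; left; apply: imset_f.
by rewrite !imset_f.
Qed.

Lemma share_right a b B x y :
  B \in blocks b -> x \in B -> y \in B ->
  connect (share_block a b) (in_right x) (in_right y).
Proof.
move=> Bb xB yB; apply/connect1/exists_inP; exists (in_right @: B).
  by apply/setUP; right; apply: imset_f.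
by rewrite !imset_f.
Qed.

Lemma block_of a x :
  exists B, [/\ B \in blocks a, x \in B, exists i, inl i \in B
                & exists j, inr j \in B].
Proof.
have /andP[aP /forall_inP aM] := blocksP a; have /and3P[/eqP cova _ _] := aP.
have xc : x \in cover a by rewrite cova inE.
exists (pblock a x); have Ba := pblock_mem xc; split=> //.
- by rewrite mem_pblock.
- by have /andP[/existsP] := aM _ Ba.
- by have /andP[_ /existsP] := aM _ Ba.
Qed.

Lemma to_left a b u : exists i, connect (share_block a b) u (in_outer (inl i)).
Proof.
have L x : exists i, connect (share_block a b) (in_left x) (in_outer (inl i)).
  have [B [Ba xB [i iB] _]] := block_of a x; exists i.
  exact: (share_left b Ba xB iB).
case: u => [x|j]; first exact: L.
have [B [Bb jB [m mB] _]] := block_of b (inr j).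
have [i ci] := L (inr m); exists i.
exact: connect_trans (share_right a Bb jB mB) ci.
Qed.

Lemma to_right a b u : exists j, connect (share_block a b) u (in_outer (inr j)).
Proof.
have L x : exists j, connect (share_block a b) (in_right x) (in_outer (inr j)).
  have [B [Ba xB _ [j jB]]] := block_of b x; exists j.
  exact: (share_right a Ba xB jB).
case: u => [[i|m]|j]; [|exact: (L (inl m))|exact: (L (inr j))].
have [B [Ba iB _ [m mB]]] := block_of a (inl i).
have [j cj] := L (inl m); exists j.
exact: connect_trans (share_left b Ba iB mB) cj.
Qed.

Lemma in_dprod a b x y :
  (exists2 D, D \in dprod_set a b & (x \in D) && (y \in D)) <->
  connect (share_block a b) (in_outer x) (in_outer y).
Proof.
have [/eqP covP trivP _] := and3P (stack_partP a b).
split=> [[D /imsetP[B BP ->]]|xy].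
  by rewrite !inE => /andP[xB yB]; rewrite -mem_stack_part (def_pblock trivP BP xB).
exists (in_outer @^-1: pblock (stack_part a b) (in_outer x)).
  by apply/imset_f/pblock_mem; rewrite covP inE.
by rewrite !inE !mem_stack_part xy connect0.
Qed.

Lemma dprod_subproof a b : dual_part (dprod_set a b).
Proof.
have [/eqP covP trivP nP] := and3P (stack_partP a b).
have meet D : D \in dprod_set a b ->
    [exists i, inl i \in D] && [exists j, inr j \in D].
  case/imsetP=> B BP ->.
  have [u uB] : exists u, u \in B by apply/set0Pn; apply: contraNneq nP => <-.
  have [i ci] := to_left a b u; have [j cj] := to_right a b u.
  by apply/andP; split; apply/existsP; [exists i|exists j];
    rewrite inE -(def_pblock trivP BP uB) mem_stack_part.
apply/andP; split; last by apply/forall_inP.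
apply/and3P; split.
- apply/eqP/setP => x; rewrite inE; apply/bigcupP.
  have [D DP /andP[xD _]] := (in_dprod a b x x).2 (connect0 _ _).
  by exists D.
- apply/trivIsetP => _ _ /imsetP[B BP ->] /imsetP[D DP ->] neq.
  have BD : B != D by apply: contraNneq neq => ->.
  rewrite -setI_eq0 -preimsetI.
  by have := trivIsetP trivP B D BP DP BD; rewrite -setI_eq0 => /eqP ->; rewrite preimset0.
- apply/negP => D0; have : exists i, inl i \in (set0 : {set Ktilde k}).
    by apply/existsP; have /andP[] := meet _ D0.
  by case=> i; rewrite inE.
Qed.

Definition dprod a b : DIS k := MkDIS (dprod_subproof a b).

HB.instance Definition _ := hasMul.Build (DIS k) dprod.

Lemma compatibleP (X : eqType) (P : {set {set Ktilde k}}) (c : Ktilde k -> X) :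
  reflect (forall B x y, B \in P -> x \in B -> y \in B -> c x = c y)
          (compatible P c).
Proof.
apply: (iffP forall_inP) => [h B x y BP xB yB|h B BP].
  by have /forall_inP/(_ x xB)/forall_inP/(_ y yB)/eqP := h B BP.
by apply/forall_inP => x xB; apply/forall_inP => y yB; apply/eqP/(h B).
Qed.

Lemma compatible_left_unique (X : eqType) a (f g h : 'I_k -> X) :
  compatible a (glue_lab f g) -> compatible a (glue_lab f h) -> g =1 h.
Proof.
move=> /compatibleP cg /compatibleP ch j.
have [B [Ba jB [i iB] _]] := block_of a (inr j).
by rewrite -[LHS](cg B _ _ Ba iB jB) -[RHS](ch B _ _ Ba iB jB).
Qed.

Lemma compatible_dprod (X : eqType) a b (f h : 'I_k -> X) :
  compatible (a * b)%g (glue_lab f h) <->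
  exists2 g : {ffun 'I_k -> X}, compatible a (glue_lab f g)
                              & compatible b (glue_lab g h).
Proof.
split=> [/compatibleP cab | [g /compatibleP ca /compatibleP cb]].
  have same x y : connect (share_block a b) (in_outer x) (in_outer y) ->
      glue_lab f h x = glue_lab f h y.
    by case/in_dprod=> D DP /andP[xD yD]; apply: cab xD yD.
  have pickP u : {i | connect (share_block a b) u (in_outer (inl i))}.
    exact/sigW/to_left.
  pose lab u := f (sval (pickP u)).
  have labE u v : connect (share_block a b) u v -> lab u = lab v.
    move=> uv; rewrite /lab; case: (pickP u) (pickP v) => [i ui] [j vj] /=.
    apply: (same (inl i) (inl j)); apply: connect_trans vj.
    by apply: connect_trans uv; rewrite share_sym.
  have labO x : lab (in_outer x) = glue_lab f h x.
    rewrite /lab; case: (pickP _) => i xi /=.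
    by rewrite -[f i]/(glue_lab f h (inl i)); apply/esym/same.
  exists [ffun j => lab (inl (inr j))]; apply/compatibleP => B x y BP xB yB.
    have labL z : glue_lab f [ffun j => lab (inl (inr j))] z = lab (in_left z).
      case: z => [i|j] /=; last by rewrite ffunE.
      exact/esym/(labO (inl i)).
    by rewrite !labL; apply/labE/(share_left b BP xB yB).
  have labR z : glue_lab [ffun j => lab (inl (inr j))] h z = lab (in_right z).
    case: z => [i|j] /=; first by rewrite ffunE.
    exact/esym/(labO (inr j)).
  by rewrite !labR; apply/labE/(share_right a BP xB yB).
apply/compatibleP => B x y BP xB yB.
have xy : connect (share_block a b) (in_outer x) (in_outer y).
  by apply/in_dprod; exists B; rewrite ?xB.
pose lab (u : Ktriple) :=
  match u with inl (inl i) => f i | inl (inr j) => g j | inr j => h j end.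
have labO z : lab (in_outer z) = glue_lab f h z by case: z.
rewrite -!labO.
have cl : closed (share_block a b) [pred w | lab (in_outer x) == lab w].
  apply: intro_closed; first exact: share_sym.
  move=> u v /exists_inP[D + /andP[+ +]] /=; rewrite !inE => DP uD vD /eqP ->.
  apply/eqP; case/orP: DP uD vD => /imsetP[E EP ->] /imsetP[z zE ->] /imsetP[w wE ->].
    by have := ca E z w EP zE wE; case: (z) (w) => ? [].
  by have := cb E z w EP zE wE; case: (z) (w) => ? [].
by have := closed_connect cl xy; rewrite !inE eqxx => /esym/eqP.
Qed.

Lemma dis_sub a b :
  (forall f g : {ffun 'I_k -> bool},
     compatible b (glue_lab f g) -> compatible a (glue_lab f g)) ->
  forall B x y, B \in blocks a -> x \in B -> y \in B -> y \in pblock b x.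
Proof.
move=> ab B x y Ba xB yB.
have /andP[/and3P[/eqP covb trivb _] _] := blocksP b.
have xc z : z \in cover b by rewrite covb inE.
pose f := [ffun i => (inl i : Ktilde k) \in pblock b x].
pose g := [ffun j => (inr j : Ktilde k) \in pblock b x].
have fgE z : glue_lab f g z = (z \in pblock b x) by case: z => ? /=; rewrite ffunE.
have /ab/compatibleP/(_ B x y Ba xB yB) : compatible b (glue_lab f g).
  apply/compatibleP => D u v Db uD vD.
  rewrite !fgE -(eq_pblock _ trivb (xc x)) -(eq_pblock _ trivb (xc x)).
  by rewrite (def_pblock trivb Db uD) (def_pblock trivb Db vD).
by rewrite !fgE mem_pblock xc.
Qed.

Lemma dis_ext a b :
  (forall f g : {ffun 'I_k -> bool},
     compatible a (glue_lab f g) = compatible b (glue_lab f g)) -> a = b.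
Proof.
move=> ab; apply: val_inj => /=.
have h c (d : DIS k) : (forall f g : {ffun 'I_k -> bool},
     compatible c (glue_lab f g) = compatible d (glue_lab f g)) ->
    blocks c \subset blocks d.
  move=> cd; apply/subsetP => B Bc.
  have [covc trivc nc] := and3P (andP (blocksP c)).1.
  have [/eqP covd trivd _] := and3P (andP (blocksP d)).1.
  have [x xB] : exists x, x \in B by apply/set0Pn; apply: contraNneq nc => <-.
  have xd z : z \in cover d by rewrite covd inE.
  suff -> : B = pblock d x by apply: pblock_mem.
  apply/setP => y; apply/idP/idP => [yB|yD].
    by apply: (dis_sub _ Bc xB yB) => f g; rewrite cd.
  rewrite -(def_pblock trivc Bc xB).
  by apply: (dis_sub _ (pblock_mem (xd x)) _ yD) => [f g|]; rewrite ?cd ?mem_pblock.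
by apply/eqP; rewrite eqEsubset !h.
Qed.

Lemma dprodA : associative (@monoid.mul (DIS k)).
Proof.
move=> a b c; apply: dis_ext => f h; apply/idP/idP.
  case/compatible_dprod=> g fg /compatible_dprod[g' gg' g'h].
  by apply/compatible_dprod; exists g' => //; apply/compatible_dprod; exists g.
case/compatible_dprod=> g' /compatible_dprod[g fg gg'] g'h.
by apply/compatible_dprod; exists g => //; apply/compatible_dprod; exists g'.
Qed.

HB.instance Definition _ := Magma_isSemigroup.Build (DIS k) dprodA.

End DualSymInv.

HB.instance Definition _ k := FinSemigroup.on (DIS k).

Local Open Scope ring_scope.
Local Open Scope quotient_scope.

Section SemigroupAlgebra.
Variables (F : fieldType) (S : finSemigroupType).

(* Coefficient families. The pointwise product of [{ffun S -> F}] is not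
   inherited; the product is [salg_mul]. *)
Definition salg : vectType F := Vector.clone F {ffun S -> F^o} _.

Definition salg_basis (s : S) : salg := [ffun t => (t == s)%:R].

Definition salg_mul (x y : salg) : salg :=
  \sum_(s : S) \sum_(t : S) (x s * y t) *: salg_basis (s * t)%g.

(* Quotient by the line spanned by [z], which is a two-sided ideal when [z] is
   a zero element; see [salg_mul_zero]. *)
Definition contracted (z : S) : Type :=
  {ideal_quot (pred_of_vspace <[salg_basis z]>%VS)}.

HB.instance Definition _ z := GRing.Zmodule.on (contracted z).
HB.instance Definition _ z := Quotient.on (contracted z).

Variable W : vectType F.

Definition salg_rep (rho : S -> 'End(W)) (x : salg) : 'End(W) :=
  \sum_(s : S) x s *: rho s.

(* The map induced on the quotient by [salg_rep rho]; see [contracted_repE]. *)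
Definition contracted_rep (z : S) (rho : S -> 'End(W)) (x : contracted z) :
  'End(W) := salg_rep rho (repr x).

Definition commutant (rho : S -> 'End(W)) (f : 'End(W)) : Prop :=
  forall s : S, (f \o rho s = rho s \o f)%VF.

Lemma salg_rep_is_linear rho : linear (salg_rep rho).
Proof.
move=> c x y; rewrite /salg_rep scaler_sumr -big_split /=.
by apply: eq_bigr => s _; rewrite !ffunE scalerDl scalerA.
Qed.

HB.instance Definition _ rho :=
  GRing.isLinear.Build F salg 'End(W) *:%R (salg_rep rho) (salg_rep_is_linear rho).

Lemma salg_rep_basis rho s : salg_rep rho (salg_basis s) = rho s.
Proof.
rewrite /salg_rep (bigD1 s) //= ffunE eqxx scale1r big1 ?addr0 // => t ts.
by rewrite ffunE (negPf ts) scale0r.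
Qed.

Lemma salg_repM rho :
  (forall s t, rho (s * t)%g = (rho s \o rho t)%VF) ->
  forall x y, salg_rep rho (salg_mul x y) = (salg_rep rho x \o salg_rep rho y)%VF.
Proof.
move=> rhoM x y; apply/lfunP => w.
have rE z v : salg_rep rho z v = \sum_s z s *: rho s v.
  by rewrite sum_lfunE; apply: eq_bigr => s _; rewrite scale_lfunE.
rewrite comp_lfunE [RHS]rE linear_sum sum_lfunE; apply: eq_bigr => s _.
rewrite rE !linear_sum sum_lfunE; apply: eq_bigr => t _.
by rewrite linearZ /= salg_rep_basis rhoM scale_lfunE comp_lfunE linearZ scalerA.
Qed.

Lemma salg_mul_zero z : (forall s, s * z = z /\ z * s = z)%g ->
  forall x y, y \in <[salg_basis z]>%VS ->
    salg_mul x y \in <[salg_basis z]>%VS /\ salg_mul y x \in <[salg_basis z]>%VS.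
Proof.
move=> z0 x _ /vlineP[c ->].
have h s : s != z -> (c *: salg_basis z) s = 0.
  by move=> sz; rewrite !ffunE (negPf sz) [LHS]mulr0.
split; apply: memv_suml => s _; apply: memv_suml => t _.
  have [->|tz] := eqVneq t z; first by rewrite (z0 s).1 memvZ ?memv_line.
  by rewrite h // mulr0 scale0r mem0v.
have [->|sz] := eqVneq s z; first by rewrite (z0 t).2 memvZ ?memv_line.
by rewrite h // mul0r scale0r mem0v.
Qed.

Lemma contracted_repE z rho : rho z = 0 ->
  forall x : salg, contracted_rep rho (\pi_(contracted z) x) = salg_rep rho x.
Proof.
move=> rz x; rewrite /contracted_rep; apply/eqP.
rewrite -subr_eq0 -linearB /=.
have : repr (\pi_(contracted z) x) - x \in <[salg_basis z]>%VS.
  by have /eqP := reprK (\pi_(contracted z) x); rewrite -Quotient.idealrBE.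
by case/vlineP=> c ->; rewrite linearZ /= salg_rep_basis rz scaler0.
Qed.

End SemigroupAlgebra.

Section Tensor.
Variables (F : fieldType) (n k : nat).

Local Notation V := 'cV[F]_n.

(* The tensor power V^{(x)k}, in coordinates with respect to the basis of pure
   tensors of standard basis vectors, indexed by N^k. *)
Definition tpow : vectType F :=
  Vector.clone F {ffun {ffun 'I_k -> 'I_n} -> F^o} _.

Definition tens (x : 'I_k -> V) : tpow :=
  [ffun i : {ffun 'I_k -> 'I_n} => \prod_(j < k) x j (i j) 0].

Definition stdv (i : 'I_n) : V := delta_mx i 0.

Definition tbasis (i : {ffun 'I_k -> 'I_n}) : tpow := tens (fun j => stdv (i j)).

Definition IS_nat_fun (p : IS n) (v : V) : V :=
  \sum_(i < n) v i 0 *: (if p i is Some j then stdv j else 0).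

Definition IS_nat (p : IS n) : 'End(V) := linfun (IS_nat_fun p).

Definition tmap_fun (f : 'End(V)) (w : tpow) : tpow :=
  \sum_i w i *: tens (fun j => f (stdv (i j))).

(* The k-th tensor power of an operator on V; see [tmap_tens]. *)
Definition tmap (f : 'End(V)) : 'End(tpow) := linfun (tmap_fun f).

Definition IS_act (p : IS n) : 'End(tpow) := tmap (IS_nat p).

Definition DIS_act_fun (a : DIS k) (w : tpow) : tpow :=
  \sum_i w i *:
    \sum_(l : {ffun 'I_k -> 'I_n} | compatible a (glue_lab i l)) tbasis l.

Definition DIS_act (a : DIS k) : 'End(tpow) := linfun (DIS_act_fun a).

Lemma tbasisE i i' : tbasis i i' = (i' == i)%:R.
Proof.
rewrite ffunE; have [->|ne] := eqVneq i' i.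
  by apply: big1 => j _; rewrite mxE !eqxx.
have [j ij] : exists j, i' j != i j.
  by apply/existsP; apply: contraNT ne; rewrite negb_exists => /forallP h;
     apply/eqP/ffunP => j; apply/eqP; move: (h j); rewrite negbK.
by rewrite (bigD1 j) //= mxE (negPf ij) mul0r.
Qed.

Lemma tpow_expand (w : tpow) : w = \sum_i w i *: tbasis i.
Proof.
apply/ffunP => i; rewrite sum_ffunE (bigD1 i) //= big1 => [|j ji].
  by rewrite ffunE tbasisE eqxx addr0 [RHS]mulr1.
by rewrite ffunE tbasisE eq_sym (negPf ji) [LHS]mulr0.
Qed.

Lemma tens_ext x y : x =1 y -> tens x = tens y.
Proof. by move=> xy; apply/ffunP => i; rewrite !ffunE; apply: eq_bigr => j _; rewrite xy. Qed.

Lemma lin_comb_linear (u : {ffun 'I_k -> 'I_n} -> tpow) :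
  linear (fun w : tpow => \sum_i w i *: u i).
Proof.
move=> c x y /=; rewrite scaler_sumr -big_split /=; apply: eq_bigr => i _.
by rewrite !ffunE scalerDl scalerA.
Qed.

HB.instance Definition _ f := GRing.isLinear.Build F tpow tpow *:%R (tmap_fun f)
  (lin_comb_linear (fun i => tens (fun j => f (stdv (i j))))).

HB.instance Definition _ a := GRing.isLinear.Build F tpow tpow *:%R (DIS_act_fun a)
  (lin_comb_linear (fun i : {ffun 'I_k -> 'I_n} =>
     \sum_(l : {ffun 'I_k -> 'I_n} | compatible a (glue_lab i l)) tbasis l)).

Lemma IS_nat_fun_linear p : linear (IS_nat_fun p).
Proof.
move=> c x y /=; rewrite scaler_sumr -big_split /=; apply: eq_bigr => i _.
by rewrite !mxE scalerDl scalerA.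
Qed.

HB.instance Definition _ p :=
  GRing.isLinear.Build F V V *:%R (IS_nat_fun p) (IS_nat_fun_linear p).

Lemma lin_comb_tbasis (u : {ffun 'I_k -> 'I_n} -> tpow) i :
  \sum_i' tbasis i i' *: u i' = u i.
Proof.
rewrite (bigD1 i) //= tbasisE eqxx scale1r big1 ?addr0 // => j ji.
by rewrite tbasisE (negPf ji) scale0r.
Qed.

Lemma IS_nat_std p i : IS_nat p (stdv i) = if p i is Some j then stdv j else 0.
Proof.
rewrite lfunE /= /IS_nat_fun (bigD1 i) //= mxE !eqxx scale1r big1 ?addr0 // => j ji.
by rewrite mxE (negPf ji) scale0r.
Qed.

Lemma cV_expand (v : V) : v = \sum_i v i 0 *: stdv i.
Proof.
by rewrite [LHS]matrix_sum_delta; apply: eq_bigr => i _; rewrite big_ord1.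
Qed.

Lemma tmap_tens f x : tmap f (tens x) = tens (fun j => f (x j)).
Proof.
rewrite lfunE /= /tmap_fun; apply/ffunP => l; rewrite sum_ffunE ffunE.
rewrite [RHS](eq_bigr (fun j => \sum_(i < n) x j i 0 * f (stdv i) (l j) 0)); last first.
  move=> j _; rewrite {1}[x j]cV_expand linear_sum summxE.
  by apply: eq_bigr => i _; rewrite linearZ mxE.
rewrite bigA_distr_bigA /=; apply: eq_bigr => i _.
by rewrite !ffunE big_split.
Qed.

Lemma lfun_tbasis (f g : 'End(tpow)) :
  (forall i, f (tbasis i) = g (tbasis i)) -> f = g.
Proof.
move=> fg; apply/lfunP => w; rewrite [w]tpow_expand !linear_sum.
by apply: eq_bigr => i _; rewrite !linearZ /= fg.
Qed.

Lemma IS_natM p q : IS_nat (p * q)%g = (IS_nat p \o IS_nat q)%VF.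
Proof.
apply/lfunP => v; rewrite [v]cV_expand !linear_sum; apply: eq_bigr => i _.
rewrite !linearZ /= comp_lfunE !IS_nat_std pcompE.
by case: (q i) => [j|] /=; rewrite ?IS_nat_std ?linear0.
Qed.

Lemma IS_actM p q : IS_act (p * q)%g = (IS_act p \o IS_act q)%VF.
Proof.
apply: lfun_tbasis => i; rewrite comp_lfunE !tmap_tens.
by apply: tens_ext => j; rewrite IS_natM comp_lfunE.
Qed.

Lemma IS_act_empty : (0 < k)%N -> IS_act (is_empty n) = 0.
Proof.
move=> k0; apply: lfun_tbasis => i; rewrite tmap_tens lfunE /=.
apply/ffunP => l; rewrite !ffunE (bigD1 (Ordinal k0)) //=.
by rewrite IS_nat_std is_emptyE mxE mul0r.
Qed.

Lemma DIS_act_tbasis a i :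
  DIS_act a (tbasis i) =
  \sum_(l : {ffun 'I_k -> 'I_n} | compatible a (glue_lab i l)) tbasis l.
Proof. by rewrite lfunE /= /DIS_act_fun lin_comb_tbasis. Qed.

Lemma DIS_actM a b : DIS_act (a * b)%g = (DIS_act b \o DIS_act a)%VF.
Proof.
apply: lfun_tbasis => i; rewrite comp_lfunE !DIS_act_tbasis linear_sum /=.
have [g cg|none] := pickP (fun g : {ffun 'I_k -> 'I_n} => compatible a (glue_lab i g)).
  rewrite [RHS](big_pred1 g) => [|g' /=].
    rewrite DIS_act_tbasis; apply: eq_bigl => h; apply/idP/idP.
      case/compatible_dprod=> g' cg'; suff -> : g' = g by [].
      exact/ffunP/(compatible_left_unique cg' cg).
    by move=> gh; apply/compatible_dprod; exists g.
  apply/idP/eqP => [cg'|->//]; exact/ffunP/(compatible_left_unique cg' cg).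
rewrite [RHS]big_pred0 // big_pred0 // => h; apply/negP.
by case/compatible_dprod=> g; rewrite none.
Qed.

End Tensor.

(* Main.v *)
From HB Require Import structures.
Require Import Defs.
From mathcomp Require Import all_boot all_order all_algebra.
From mathcomp Require Import reals complex.

Set Implicit Arguments.
Unset Strict Implicit.
Unset Printing Implicit Defensive.

Import GRing.Theory.
Local Open Scope ring_scope.

(** In the basis of pure tensors, indexed by words of length [k] over ['I_n],
    both semigroups act by matrices of partial injections on words
    ([IS_rel_pinj], [DIS_rel_pinj]). They commute because a partial injection
    [p] sending the word [i] to [i'] and [l] to [l'] sends the colouring
    [glue_lab i l] of the points of [Ktilde k] to [glue_lab i' l'], which has the
    same kernel, and compatibility with a partition depends on the kernel only.

    The double commutant property needs no semisimplicity. A pair of words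
    [(i, l)] has two kinds of invariants: the kernel of [glue_lab i l], which is
    an element of the dual semigroup as soon as [i] and [l] use the same letters;
    and the partial injection with domain the letters of [i] that sends [i] to
    [l], which exists as soon as [i] and [l] have the same kernel. An operator
    commuting with a partial injection [r] has equal entries at [(i, i')] and
    [(l, l')] whenever [r] sends [i] to [l] and [i'] to [l'] ([commuting_entry]).
    Its entry at [(i, i')] vanishes when [r] is defined on [i'] but not on [i]
    ([commuting_entry_domain]), and its entry at [(l, l')] vanishes when [r]
    attains [l] but not [l'] ([commuting_entry_range]). Applied to the symmetric inverse
    semigroup this says that the entry at [(i, l)] depends on the kernel only and
    vanishes when there is none; applied to the dual semigroup it says the same
    for the partial injection.

    On the other side, the entry at a pair with invariant [s] of the operator of
    a semigroup element [t] is 1 if [t <= s] and 0 otherwise, where [<=] is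
    refinement of partitions in one case and extension of partial maps in the
    other. The family is thus unitriangular, and inversion over the finite poset
    ([downset_sums_onto]) expresses every operator whose entries depend on the
    invariant alone as a combination of the family ([triangular_span]).

    The same triangularity decides faithfulness of the algebras: the
    combinations are determined by their operator exactly when every element is
    the invariant of some pair of words. The partition into [k] pairs [{j, j'}]
    needs [k] letters, and [k] letters suffice for all partitions; the identity
    map needs words with [n] distinct letters, and length [n] suffices for every
    nonempty partial injection. The empty map is never an invariant, which is why
    it has to be divided out. *)

(** * Inversion over a finite poset *)

Section ZetaInversion.
Variables (F : fieldType) (S : finType) (le : rel S).
Hypotheses (le_refl : reflexive le) (le_anti : antisymmetric le).
Hypothesis le_trans : transitive le.

(** Triangularity: by induction on the number of elements below [b], all terms
    of its sum other than [x b] already vanish. *)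
Lemma downset_sums_eq0 (x : S -> F) :
  (forall b, \sum_(a | le a b) x a = 0) -> forall b, x b = 0.
Proof.
move=> sum0 b; have [m] := ubnP #|[pred a | le a b]|.
elim: m b => // m IHm b /ltnSE leb.
have := sum0 b; rewrite (bigD1 b) //= big1 ?addr0 // => a /andP[ab a_neq_b].
apply: IHm; apply: leq_trans leb; apply/proper_card/properP; split.
  by apply/subsetP => c; rewrite !inE => ca; apply: le_trans ab.
exists b; rewrite !inE //; apply: contra a_neq_b => ba.
by apply/eqP/le_anti; rewrite ab.
Qed.

Definition downset_sums (x : {ffun S -> F^o}) : {ffun S -> F^o} :=
  [ffun b => \sum_(a | le a b) x a].

Lemma downset_sums_is_linear : linear downset_sums.
Proof.
move=> c x y; apply/ffunP => b; rewrite !ffunE scaler_sumr -big_split /=.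
by apply: eq_bigr => a _; rewrite !ffunE.
Qed.

HB.instance Definition _ := GRing.isLinear.Build F {ffun S -> F^o}
  {ffun S -> F^o} *:%R downset_sums downset_sums_is_linear.

(** Möbius inversion without the Möbius function: an injective endomorphism of a
    finite-dimensional space is onto. *)
Lemma downset_sums_onto (y : S -> F) :
  exists x : {ffun S -> F^o}, forall b, \sum_(a | le a b) x a = y b.
Proof.
have inj : lker (linfun downset_sums) == 0%VS.
  rewrite -subv0; apply/subvP => x; rewrite memv_ker memv0 lfunE /=.
  move=> /eqP/ffunP x0; apply/eqP/ffunP => b; rewrite [RHS]ffunE.
  by apply: downset_sums_eq0 => {}b; have := x0 b; rewrite !ffunE.
exists ((linfun downset_sums)^-1%VF [ffun b => y b]) => b.
have /ffunP/(_ b) := lker0_lfunVK inj [ffun b => y b].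
by rewrite lfunE /= !ffunE.
Qed.

End ZetaInversion.

(** * Kernels of colourings *)

Definition same_kernel (T : finType) (X Y : eqType) (c : T -> X) (d : T -> Y) :
  bool := [forall x, forall y, (c x == c y) == (d x == d y)].

Lemma same_kernelP (T : finType) (X Y : eqType) (c : T -> X) (d : T -> Y) :
  reflect (forall x y, (c x == c y) = (d x == d y)) (same_kernel c d).
Proof.
apply: (iffP forallP) => [h x y|h x]; last by apply/forallP => y; rewrite h.
by have /forallP/(_ y)/eqP := h x.
Qed.

Lemma same_kernel_sym (T : finType) (X Y : eqType) (c : T -> X) (d : T -> Y) :
  same_kernel c d = same_kernel d c.
Proof. by apply/same_kernelP/same_kernelP => h x y; rewrite h. Qed.

Lemma same_kernel_trans (T : finType) (X Y Z : eqType)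
    (c : T -> X) (d : T -> Y) (e : T -> Z) :
  same_kernel c d -> same_kernel d e -> same_kernel c e.
Proof.
by move=> /same_kernelP cd /same_kernelP de; apply/same_kernelP=> x y; rewrite cd.
Qed.

Section PartialInjections.
Variable n : nat.
Implicit Types p q : IS n.

Lemma IS_same_kernel (T : finType) p (c d : T -> 'I_n) :
  (forall x, p (c x) = Some (d x)) -> same_kernel c d.
Proof.
move=> pcd; apply/same_kernelP => x y; apply/eqP/eqP => [cxy|dxy].
  by apply: Some_inj; rewrite -!pcd cxy.
by apply: (is_inj (pcd x)); rewrite pcd dxy.
Qed.

Definition dictionary_fun (T : finType) (c d : T -> 'I_n) :
    {ffun 'I_n -> option 'I_n} :=
  [ffun u => omap d [pick x | c x == u]].

(** Two colourings with the same kernel are related by a dictionary between their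
    colours, and such a dictionary is a partial injection. Only colours of [c]
    are translated, so that [q] is the least one possible. *)
Lemma same_kernel_IS (T : finType) (c d : T -> 'I_n) : same_kernel c d ->
  exists q : IS n, (forall x, q (c x) = Some (d x)) /\
                   (forall u, q u != None -> exists x, c x = u).
Proof.
move=> /same_kernelP cd.
have inj : partial_inj (dictionary_fun c d).
  apply/forallP => u; apply/forallP => v; apply/implyP; rewrite !ffunE.
  case: pickP => [x /eqP <-|_] //=; last by rewrite andbF.
  by case: pickP => [y /eqP <-|_] //=; rewrite andbT cd.
exists (MkIS inj); split=> [x|u] /=; rewrite ffunE.
  case: pickP => [y|/(_ x)]; last by rewrite eqxx.
  by rewrite cd => /eqP /= ->.
by case: pickP => [x /eqP <-|_] //= _; exists x.
Qed.

(** The natural order: [p] extends [q]. *)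
Definition IS_le q p : bool := [forall u, (q u != None) ==> (p u == q u)].

Lemma IS_leP q p :
  reflect (forall u v, q u = Some v -> p u = Some v) (IS_le q p).
Proof.
apply: (iffP forallP) => [h u v qu|h u]; last first.
  by case qu: (q u) => [v|] //=; rewrite (h u v).
by have := h u; rewrite qu => /eqP.
Qed.

Lemma IS_le_refl : reflexive IS_le. Proof. by move=> p; apply/IS_leP. Qed.

Lemma IS_le_anti : antisymmetric IS_le.
Proof.
move=> p q /andP[/IS_leP pq /IS_leP qp]; apply/val_inj/ffunP => u /=.
case pu: (p u) => [v|]; first by rewrite (pq u v).
by case qu: (q u) => [v|] //; rewrite (qp u v) in pu.
Qed.

Lemma IS_le_trans : transitive IS_le.
Proof.
move=> q p r /IS_leP pq /IS_leP qr.
by apply/IS_leP => u v pu; apply: qr; apply: pq.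
Qed.

End PartialInjections.

Section DualPartitions.
Variable k : nat.
Implicit Types (a b : DIS k).

Lemma pblock_DIS a x y : (y \in pblock a x) = (pblock a x == pblock a y).
Proof.
have /andP[/and3P[/eqP cova triva _] _] := blocksP a.
by rewrite eq_pblock // cova inE.
Qed.

Lemma compatible_pblock (X : eqType) a (c : Ktilde k -> X) :
  reflect (forall x y, pblock a x == pblock a y -> c x = c y) (compatible a c).
Proof.
have /andP[/and3P[/eqP cova triva _] _] := blocksP a.
apply: (iffP (compatibleP _ _)) => [h x y xy|h B x y Ba xB yB].
  apply: (h (pblock a x)); rewrite ?pblock_DIS //.
  by rewrite pblock_mem // cova inE.
by apply: h; rewrite (def_pblock triva Ba xB) (def_pblock triva Ba yB).
Qed.

Lemma compatible_same_kernel (X Y : eqType) a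
    (c : Ktilde k -> X) (d : Ktilde k -> Y) :
  same_kernel c d -> compatible a c = compatible a d.
Proof.
move=> /same_kernelP cd; apply/compatible_pblock/compatible_pblock => h x y xy;
  apply/eqP.
  by rewrite -cd (h x y xy).
by rewrite cd (h x y xy).
Qed.

(** Refinement, stated through the block map of [b] so that comparing partitions
    is a case of compatibility with a colouring. *)
Definition DIS_le a b : bool := compatible a (pblock b).

Lemma compatible_le (X : eqType) a b (c : Ktilde k -> X) :
  DIS_le a b -> compatible b c -> compatible a c.
Proof.
move=> /compatible_pblock ab /compatible_pblock bc.
by apply/compatible_pblock => x y /ab/eqP; apply: bc.
Qed.

Lemma DIS_le_refl : reflexive DIS_le.
Proof. by move=> a; apply/compatible_pblock => x y /eqP. Qed.

Lemma DIS_le_trans : transitive DIS_le.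
Proof. by move=> b a c ab; apply: compatible_le. Qed.

Lemma DIS_le_anti : antisymmetric DIS_le.
Proof.
move=> a b /andP[ab ba]; apply: dis_ext => f g.
by apply/idP/idP; [exact: compatible_le ba | exact: compatible_le ab].
Qed.

(** Every colour seen on one row is also seen on the other. *)
Definition crossing (X : eqType) (c : Ktilde k -> X) :=
  (forall i, exists j, c (inl i) = c (inr j)) /\
  (forall j, exists i, c (inl i) = c (inr j)).

Lemma compatible_crossing (X : eqType) a (c : Ktilde k -> X) :
  compatible a c -> crossing c.
Proof.
move=> /compatibleP ac; split=> [i|j].
  by have [B [Ba iB _ [j jB]]] := block_of a (inl i); exists j; apply: (ac B).
by have [B [Ba jB [i iB] _]] := block_of a (inr j); exists i; apply: (ac B).
Qed.

(** The parts of the kernel are the colour classes, and crossing says that each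
    of them meets both rows. *)
Lemma crossing_kernel (X : eqType) (c : Ktilde k -> X) :
  crossing c -> exists a : DIS k, same_kernel (pblock a) c.
Proof.
move=> [down up]; have eqv : {in setT & &, equivalence_rel (relpre c eq_op)}.
  by move=> x y z _ _ _ /=; split=> // /eqP ->.
pose P := preim_partition c setT.
have Ppart : partition P setT by apply: preim_partitionP.
have PE x y : (y \in pblock P x) = (c x == c y).
  by rewrite pblock_equivalence_partition.
have Pdual : dual_part P.
  apply/andP; split=> //; apply/forall_inP => B BP.
  have [_ trivP nP] := and3P Ppart.
  have [x xB] : exists x, x \in B by apply/set0Pn; apply: contraNneq nP => <-.
  rewrite -(def_pblock trivP BP xB); apply/andP.
  case: x {xB} => [i|j]; [have [j ij] := down i | have [i ij] := up j];
    by split; apply/existsP; [exists i | exists j]; rewrite PE -?ij ?eqxx.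
exists (MkDIS Pdual); apply/same_kernelP => x y.
by rewrite -pblock_DIS PE.
Qed.

Lemma kernel_compatible (X : eqType) a b (c : Ktilde k -> X) :
  same_kernel (pblock b) c -> compatible a c = DIS_le a b.
Proof. by move=> bc; rewrite -(compatible_same_kernel a bc). Qed.

Lemma compatible_right_unique (X : eqType) a (f g h : 'I_k -> X) :
  compatible a (glue_lab f h) -> compatible a (glue_lab g h) -> f =1 g.
Proof.
move=> /compatibleP cf /compatibleP cg i.
have [B [Ba iB _ [j jB]]] := block_of a (inl i).
by rewrite -[LHS]/(glue_lab f h (inl i)) -[RHS]/(glue_lab g h (inl i))
  (cf B _ _ Ba iB jB) (cg B _ _ Ba iB jB).
Qed.

End DualPartitions.

(** * Operators as matrices indexed by words *)

Section Entries.
Variables (F : fieldType) (n k : nat).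
Local Notation word := {ffun 'I_k -> 'I_n}.
Local Notation operator := 'End(tpow F n k).
Implicit Types (i l m : word) (f g : operator) (r s : rel word).

Definition entry f i l : F := f (tbasis F i) l.

Lemma entry_ext f g : (forall i l, entry f i l = entry g i l) -> f = g.
Proof. by move=> fg; apply: lfun_tbasis => i; apply/ffunP => l; apply: fg. Qed.

Lemma entry_comp f g i l :
  entry (f \o g)%VF i l = \sum_m entry g i m * entry f m l.
Proof.
rewrite /entry comp_lfunE {1}[g (tbasis F i)]tpow_expand linear_sum sum_ffunE.
by apply: eq_bigr => m _; rewrite linearZ ffunE.
Qed.

Definition partial_injection r :=
  (forall i l l', r i l -> r i l' -> l = l') /\
  (forall i i' l, r i l -> r i' l -> i = i').

(** The two products [f \o g] and [g \o f] sum entries of [f] over the image of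
    [i], respectively over the preimage of [l]. Each of these sets has at most one
    element, so three facts follow, according to which of them is empty. *)
Section CommutingWithPartialInjection.
Variables (r : rel word) (g f : operator).
Hypothesis r_pinj : partial_injection r.
Hypothesis gE : forall i l, entry g i l = (r i l)%:R.
Hypothesis fg : (f \o g = g \o f)%VF.

Let fgE i l : \sum_(m | r i m) entry f m l = \sum_(m | r m l) entry f i m.
Proof.
have := congr1 (fun h => entry h i l) fg; rewrite !entry_comp => E.
rewrite big_mkcond [RHS]big_mkcond /=; apply: etrans (etrans E _).
  by apply: eq_bigr => m _; rewrite gE; case: (r i m); rewrite ?mul1r ?mul0r.
by apply: eq_bigr => m _; rewrite gE; case: (r m l); rewrite ?mulr1 ?mulr0.
Qed.

Let sum_image i l h : r i l -> \sum_(m | r i m) h m = h l :> F.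
Proof.
move=> il; rewrite (big_pred1 l) // => m.
by apply/idP/eqP => [im|->//]; apply: r_pinj.1 im il.
Qed.

Let sum_preimage i l h : r i l -> \sum_(m | r m l) h m = h i :> F.
Proof.
move=> il; rewrite (big_pred1 i) // => m.
by apply/idP/eqP => [ml|->//]; apply: r_pinj.2 ml il.
Qed.

Lemma commuting_entry i i' l l' :
  r i l -> r i' l' -> entry f i i' = entry f l l'.
Proof.
move=> il i'l'; have := fgE i l'.
by rewrite (sum_image _ il) (sum_preimage _ i'l').
Qed.

Lemma commuting_entry_range i l l' :
  r i l -> entry f l l' != 0 -> exists i', r i' l'.
Proof.
move=> il; rewrite -(sum_image (fun m => entry f m l') il) fgE.
case: (pickP (r^~ l')) => [i' i'l' _|none]; first by exists i'.
by rewrite big_pred0 ?eqxx.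
Qed.

Lemma commuting_entry_domain i i' l' :
  r i' l' -> entry f i i' != 0 -> exists l, r i l.
Proof.
move=> i'l'; rewrite -(sum_preimage (entry f i) i'l') -fgE.
case: (pickP (r i)) => [l il _|none]; first by exists l.
by rewrite big_pred0 ?eqxx.
Qed.

End CommutingWithPartialInjection.

Lemma partial_injections_commute r s f g :
  partial_injection r -> partial_injection s ->
  (forall i l, entry f i l = (r i l)%:R) ->
  (forall i l, entry g i l = (s i l)%:R) ->
  (forall i l, (exists2 m, r i m & s m l) <-> (exists2 m, s i m & r m l)) ->
  (f \o g = g \o f)%VF.
Proof.
have compE r' s' f' g' i l : partial_injection s' ->
    (forall i l, entry f' i l = (r' i l)%:R) ->
    (forall i l, entry g' i l = (s' i l)%:R) ->
    entry (f' \o g')%VF i l = [exists m, s' i m && r' m l]%:R.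
  move=> pinj fE gE; rewrite entry_comp.
  case: existsP => [[m /andP[sim rml]]|none]; last first.
    rewrite big1 // => m _; rewrite fE gE -natrM mulnb.
    by case: andP => // h; case: none; exists m; apply/andP.
  rewrite (bigD1 m) //= fE gE sim rml mul1r big1 ?addr0 // => m' m'm.
  rewrite gE; case: (boolP (s' i m')) => [sim'|_]; last by rewrite mul0r.
  by rewrite (pinj.1 _ _ _ sim sim') eqxx in m'm.
move=> rp sp fE gE rs; apply: entry_ext => i l.
rewrite (compE r s) // (compE s r) //; congr (_%:R); congr nat_of_bool.
apply/existsP/existsP => [[m /andP[h1 h2]]|[m /andP[h1 h2]]].
  by have [|m' h3 h4] := (rs i l).2; [exists m | exists m'; rewrite h3].
by have [|m' h3 h4] := (rs i l).1; [exists m | exists m'; rewrite h3].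
Qed.

End Entries.

(** * Families of operators triangular with respect to a pattern *)

(** A pattern is an invariant of a pair of words with values in the semigroup,
    defined for some pairs only. The two hypotheses on entries say that it
    determines the entries of all the operators [g t] in a unitriangular way. *)
Section TriangularFamily.
Variables (F : fieldType) (n k : nat) (S : finSemigroupType).
Local Notation word := {ffun 'I_k -> 'I_n}.
Variables (g : S -> 'End(tpow F n k)) (le : rel S).
Variable pattern : S -> rel word.
Hypotheses (le_refl : reflexive le) (le_anti : antisymmetric le).
Hypothesis le_trans : transitive le.
Hypothesis entry_pattern : forall s t i l,
  pattern s i l -> entry (g t) i l = (le t s)%:R.
Hypothesis entry_no_pattern : forall t i l,
  entry (g t) i l != 0 -> exists s, pattern s i l.

Lemma entry_salg_rep (x : salg F S) i l :
  entry (salg_rep g x) i l = \sum_t x t * entry (g t) i l.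
Proof.
rewrite /entry /salg_rep sum_lfunE sum_ffunE; apply: eq_bigr => t _.
by rewrite scale_lfunE ffunE.
Qed.

Lemma salg_rep_pattern (x : salg F S) s i l :
  pattern s i l -> entry (salg_rep g x) i l = \sum_(t | le t s) x t.
Proof.
move=> sil; rewrite entry_salg_rep [RHS]big_mkcond /=; apply: eq_bigr => t _.
by rewrite (entry_pattern t sil); case: (le t s); rewrite ?mulr1 ?mulr0.
Qed.

Lemma salg_rep_no_pattern (x : salg F S) i l :
  (forall s, ~~ pattern s i l) -> entry (salg_rep g x) i l = 0.
Proof.
move=> none; rewrite entry_salg_rep big1 // => t _.
case: (eqVneq (entry (g t) i l) 0) => [->|]; first by rewrite mulr0.
by case/entry_no_pattern=> s; rewrite (negPf (none s)).
Qed.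

(** The common value of [f] on each pattern is a function on the semigroup, and
    inverting it over [le] gives the coefficients. *)
Lemma triangular_span (f : 'End(tpow F n k)) :
  (forall i l, entry f i l != 0 -> exists s, pattern s i l) ->
  (forall s i l i' l', pattern s i l -> pattern s i' l' ->
     entry f i l = entry f i' l') ->
  exists x : salg F S, f = salg_rep g x.
Proof.
move=> supp const.
(* The value at elements that are not patterns is arbitrary. *)
pose y s := if [pick il | pattern s il.1 il.2] is Some il
            then entry f il.1 il.2 else 0.
have [x xy] := downset_sums_onto le_refl le_anti le_trans y.
exists x; apply: entry_ext => i l.
have [/existsP[s sil]|] := boolP [exists s, pattern s i l]; last first.
  rewrite negb_exists => /forallP none; rewrite salg_rep_no_pattern //.
  by apply/eqP; apply: contraT => /supp[s]; rewrite (negPf (none s)).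
rewrite (salg_rep_pattern x sil) xy /y; case: pickP => [il|/(_ (i, l))].
  exact: const.
by rewrite sil.
Qed.

(** The operator of [x] sees the sums of [x] below [s] only for those [s] that
    occur as patterns, so inverting the indicator function of another element
    gives a relation. The sum equal to 1 shows that the relation is nontrivial. *)
Lemma triangular_relation s : (forall i l, ~~ pattern s i l) ->
  exists x : salg F S, \sum_(t | le t s) x t = 1 /\ salg_rep g x = 0.
Proof.
move=> invis.
have [x xs] := downset_sums_onto le_refl le_anti le_trans (fun t => (t == s)%:R : F).
exists x; split; first by rewrite xs eqxx.
apply: entry_ext => i l; rewrite [RHS]/entry lfunE /= ffunE.
have [/existsP[t til]|] := boolP [exists t, pattern t i l].
  rewrite (salg_rep_pattern x til) xs; case: eqP => // ts.
  by rewrite ts (negPf (invis i l)) in til.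
by rewrite negb_exists => /forallP; apply: salg_rep_no_pattern.
Qed.

End TriangularFamily.

(** * The two families of partial injections on words *)

Section SchurWeyl.
Variables (F : fieldType) (n k : nat).
Local Notation word := {ffun 'I_k -> 'I_n}.
Local Notation operator := 'End(tpow F n k).
Local Notation rho := (@IS_act F n k).
Local Notation sigma := (@DIS_act F n k).
Implicit Types (i l m : word) (f : operator) (p q : IS n) (a b : DIS k).

Definition IS_rel p : rel word := fun i l => [forall j, p (i j) == Some (l j)].

Definition DIS_rel a : rel word := fun i l => compatible a (glue_lab i l).

Lemma IS_relP p i l : reflect (forall j, p (i j) = Some (l j)) (IS_rel p i l).
Proof. by apply: (iffP forallP) => h j; apply/eqP; rewrite h. Qed.

Lemma entry_IS_act (p : IS n) i l :
  entry (rho p) i l = (IS_rel p i l)%:R.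
Proof.
rewrite /entry /IS_act /tbasis tmap_tens ffunE; case: IS_relP => [pil|npil].
  by apply: big1 => j _; rewrite IS_nat_std pil mxE !eqxx.
have /existsP[j pj] : [exists j, p (i j) != Some (l j)].
  by rewrite -negb_forall; apply/IS_relP.
rewrite (bigD1 j) //= IS_nat_std; case: (p (i j)) pj => [u|] ul; rewrite mxE.
  rewrite andbT; case: eqP => [lu|_]; last by rewrite mul0r.
  by rewrite lu eqxx in ul.
by rewrite mul0r.
Qed.

Lemma entry_DIS_act (a : DIS k) i l :
  entry (sigma a) i l = (DIS_rel a i l)%:R.
Proof.
rewrite /entry DIS_act_tbasis sum_ffunE.
have [ail|nail] := boolP (DIS_rel a i l).
  rewrite (bigD1 l ail) /= tbasisE eqxx big1 ?addr0 // => m /andP[_ ml].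
  by rewrite tbasisE eq_sym (negPf ml).
rewrite big1 // => m am; rewrite tbasisE; case: eqP => // lm.
by rewrite lm /DIS_rel am in nail.
Qed.

Lemma IS_rel_pinj p : partial_injection (IS_rel p).
Proof.
split=> [i l l' /IS_relP il /IS_relP il'|i i' l /IS_relP il /IS_relP i'l].
  by apply/ffunP => j; apply: Some_inj; rewrite -il -il'.
by apply/ffunP => j; apply: is_inj (il j) (i'l j).
Qed.

Lemma DIS_rel_pinj a : partial_injection (DIS_rel a).
Proof.
by split=> i l m il im; apply/ffunP; [apply: compatible_left_unique il im
                                     | apply: compatible_right_unique il im].
Qed.

(** Compatibility of [glue_lab i l] depends on its kernel only, and the injective
    [p] preserves the kernel. *)
Lemma IS_DIS_rel_transport p a i i' l l' :
  IS_rel p i i' -> IS_rel p l l' -> DIS_rel a i l = DIS_rel a i' l'.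
Proof.
move=> /IS_relP ii' /IS_relP ll'.
by apply/compatible_same_kernel/(@IS_same_kernel _ _ p) => -[].
Qed.

(** Compatibility forces the outer words to use the same letters as the middle
    one, so [p] is defined on, or attains, every letter that is needed. *)
Lemma DIS_IS_rel_commute p a i l :
  (exists2 m, IS_rel p i m & DIS_rel a m l) <->
  (exists2 m, DIS_rel a i m & IS_rel p m l).
Proof.
split=> [[m im ml]|[m im ml]].
  have Pl j : {u | p u == Some (l j)}.
    apply: sigW; have [_ /(_ j)[j' /= <-]] := compatible_crossing ml.
    by exists (i j'); apply/eqP/IS_relP.
  pose m' : word := [ffun j => sval (Pl j)].
  have m'l : IS_rel p m' l.
    by apply/IS_relP => j; rewrite ffunE; apply/eqP/(svalP (Pl j)).
  by exists m' => //; rewrite (IS_DIS_rel_transport a im m'l).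
have Pi j : {v | p (i j) == Some v}.
  apply: sigW; have [/(_ j)[j' /= ->] _] := compatible_crossing im.
  by exists (l j'); apply/eqP/IS_relP.
pose m' : word := [ffun j => sval (Pi j)].
have im' : IS_rel p i m'.
  by apply/IS_relP => j; rewrite ffunE; apply/eqP/(svalP (Pi j)).
by exists m' => //; rewrite -(IS_DIS_rel_transport a im' ml).
Qed.

Lemma actions_commute p a :
  (rho p \o sigma a = sigma a \o rho p)%VF.
Proof.
apply: (partial_injections_commute (IS_rel_pinj p) (DIS_rel_pinj a)).
- exact: entry_IS_act.
- exact: entry_DIS_act.
- exact: DIS_IS_rel_commute.
Qed.

(** The clause on the domain picks the least partial injection sending [i] to
    [l]. *)
Definition IS_pattern q : rel word := fun i l =>
  IS_rel q i l && [forall u, (q u != None) ==> [exists j, i j == u]].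

Lemma IS_patternP q i l :
  reflect (IS_rel q i l /\ forall u, q u != None -> exists j, i j = u)
          (IS_pattern q i l).
Proof.
apply: (iffP andP) => -[il dom]; split=> //.
  move=> u /(implyP (forallP dom u))/existsP[j /eqP ij]; by exists j.
apply/forallP => u; apply/implyP => /dom[j <-]; apply/existsP; by exists j.
Qed.

Definition DIS_pattern b : rel word :=
  fun i l => same_kernel (pblock b) (glue_lab i l).

Lemma IS_pattern_exists i l :
  same_kernel i l -> exists q, IS_pattern q i l.
Proof.
move=> /same_kernel_IS[q [il dom]]; exists q; apply/IS_patternP.
by split=> //; apply/IS_relP.
Qed.

Lemma entry_IS_pattern q p i l :
  IS_pattern q i l -> entry (rho p) i l = (IS_le q p)%:R.
Proof.
move=> /IS_patternP[/IS_relP qil dom]; rewrite entry_IS_act.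
congr (_%:R); congr nat_of_bool; apply/(IS_relP p i l)/IS_leP => [pil u v qu|qp j].
  have [|j ij] := dom u; first by rewrite qu.
  by rewrite -qu -ij pil qil.
exact/qp/qil.
Qed.

Lemma entry_IS_no_pattern p i l :
  entry (rho p) i l != 0 -> exists q, IS_pattern q i l.
Proof.
rewrite entry_IS_act; case: IS_relP => [pil _|_]; last by rewrite eqxx.
exact: IS_pattern_exists (IS_same_kernel pil).
Qed.

Lemma entry_DIS_pattern b a i l :
  DIS_pattern b i l -> entry (sigma a) i l = (DIS_le a b)%:R.
Proof. by move=> bil; rewrite entry_DIS_act /DIS_rel (kernel_compatible a bil). Qed.

Lemma entry_DIS_no_pattern a i l :
  entry (sigma a) i l != 0 -> exists b, DIS_pattern b i l.
Proof.
rewrite entry_DIS_act; case: (boolP (DIS_rel a i l)) => [ail _|_].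
  exact/crossing_kernel/(compatible_crossing ail).
by rewrite eqxx.
Qed.

(** The opposite of the natural order: the operator of [p] has a nonzero entry at
    the pattern [q] when [p] extends [q]. *)
Definition IS_ge : rel (IS n) := fun p q => IS_le q p.

Lemma IS_ge_refl : reflexive IS_ge. Proof. exact: IS_le_refl. Qed.
Lemma IS_ge_anti : antisymmetric IS_ge.
Proof. by move=> p q; rewrite /IS_ge andbC; apply: IS_le_anti. Qed.
Lemma IS_ge_trans : transitive IS_ge.
Proof. by move=> q p r pq qr; apply: IS_le_trans qr pq. Qed.

(** * The commutant of the symmetric inverse semigroup *)

Section CommutantIS.
Variable f : operator.
Hypothesis comm : commutant rho f.

Let f_entry p i i' l l' :
  IS_rel p i l -> IS_rel p i' l' -> entry f i i' = entry f l l'.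
Proof.
move=> il i'l'.
exact: (commuting_entry (IS_rel_pinj p) (entry_IS_act p) (comm p) il i'l').
Qed.

(** The idempotent of the letters of a word fixes that word. Fixing [l] while [f]
    has a nonzero entry at [(i, l)], it must be defined on [i]; fixing [i], it
    must attain [l]. Hence [i] and [l] use the same letters. *)
Lemma commutant_IS_support i l :
  entry f i l != 0 -> exists b, DIS_pattern b i l.
Proof.
have idem (m : word) :
    exists p, IS_rel p m m /\ forall u, p u != None -> exists j, m j = u.
  have [|p [mm dom]] := @same_kernel_IS n _ m m; first exact/same_kernelP.
  by exists p; split=> //; apply/IS_relP.
move=> fil; apply: crossing_kernel; split=> j /=.
  have [p [ll dom]] := idem l.
  have [m /IS_relP im] := commuting_entry_domain (IS_rel_pinj p)
    (entry_IS_act p) (comm p) ll fil.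
  have [|j' lj'] := dom (i j); first by rewrite im.
  by exists j'.
have [p [ii dom]] := idem i.
have [m /IS_relP ml] := commuting_entry_range (IS_rel_pinj p)
  (entry_IS_act p) (comm p) ii fil.
have [|j' ij'] := dom (m j); first by rewrite ml.
by exists j'; apply: Some_inj; rewrite -ml -ij'; apply/esym/(IS_relP _ _ _ ii).
Qed.

(** Two pairs with the same kernel are related by a dictionary, acting
    simultaneously on both words. *)
Lemma commutant_IS_constant b i l i' l' :
  DIS_pattern b i l -> DIS_pattern b i' l' -> entry f i l = entry f i' l'.
Proof.
rewrite /DIS_pattern same_kernel_sym => il i'l'.
have [p [pE _]] := same_kernel_IS (same_kernel_trans il i'l').
apply: (@f_entry p); apply/IS_relP => j.
  exact: (pE (inl j)).
exact: (pE (inr j)).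
Qed.

End CommutantIS.

Lemma commutant_IS f :
  commutant rho f <-> exists x : salg F (DIS k), f = salg_rep sigma x.
Proof.
split=> [comm|[x ->] p]; last first.
  apply/lfunP => w; rewrite !comp_lfunE /salg_rep !sum_lfunE linear_sum.
  apply: eq_bigr => a _; rewrite !scale_lfunE linearZ /=.
  by rewrite -!comp_lfunE actions_commute.
apply: (triangular_span (@DIS_le_refl k) (@DIS_le_anti k) (@DIS_le_trans k)
  (pattern := DIS_pattern)).
- by move=> b a i l; apply: entry_DIS_pattern.
- exact: entry_DIS_no_pattern.
- exact: commutant_IS_support.
- exact: commutant_IS_constant.
Qed.

(** * The commutant of the dual semigroup *)

Section CommutantDIS.
Variable f : operator.
Hypothesis comm : commutant sigma f.

(** The kernel of [glue_lab m m] is an idempotent that fixes exactly the words at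
    least as coarse as [m]. Used with [m = i] and [m = l], it gives the two
    inclusions between the kernels of [i] and [l]. *)
Lemma commutant_DIS_support i l :
  entry f i l != 0 -> exists q, IS_pattern q i l.
Proof.
have idem (m : word) : exists a, same_kernel (pblock a) (glue_lab m m).
  by apply: crossing_kernel; split=> j; exists j.
move=> fil; apply: IS_pattern_exists; apply/same_kernelP => x y.
apply/eqP/eqP => [ixy|lxy].
  have [a ai] := idem i.
  have ii : DIS_rel a i i by rewrite /DIS_rel (kernel_compatible a ai) DIS_le_refl.
  have [m ml] := commuting_entry_range (DIS_rel_pinj a) (entry_DIS_act a)
    (comm a) ii fil.
  have /compatible_pblock/(_ (inr x) (inr y)) := ml; apply.
  by have /same_kernelP -> := ai; rewrite /= ixy.
have [a al] := idem l.
have ll : DIS_rel a l l by rewrite /DIS_rel (kernel_compatible a al) DIS_le_refl.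
have [m im] := commuting_entry_domain (DIS_rel_pinj a) (entry_DIS_act a)
  (comm a) ll fil.
have /compatible_pblock/(_ (inl x) (inl y)) := im; apply.
by have /same_kernelP -> := al; rewrite /= lxy.
Qed.

(** Both [i] and [i'] list the domain of [q], so the kernel of [glue_lab i i'] is
    a dual partition sending [i] to [i']; as [q] preserves kernels, it also sends
    [l] to [l']. *)
Lemma commutant_DIS_constant q i l i' l' :
  IS_pattern q i l -> IS_pattern q i' l' -> entry f i l = entry f i' l'.
Proof.
move=> /IS_patternP[il dom] /IS_patternP[i'l' dom'].
have cross : crossing (glue_lab i i').
  split=> j /=.
    have [|j' ij'] := dom' (i j); first by rewrite (IS_relP _ _ _ il).
    by exists j'.
  have [|j' ij'] := dom (i' j); first by rewrite (IS_relP _ _ _ i'l').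
  by exists j'.
have [a ai] := crossing_kernel cross.
have ii' : DIS_rel a i i' by rewrite /DIS_rel (kernel_compatible a ai) DIS_le_refl.
have ll' : DIS_rel a l l' by rewrite -(IS_DIS_rel_transport a il i'l').
exact: (commuting_entry (DIS_rel_pinj a) (entry_DIS_act a) (comm a) ii' ll').
Qed.

End CommutantDIS.

Lemma commutant_DIS f :
  commutant sigma f <-> exists x : salg F (IS n), f = salg_rep rho x.
Proof.
split=> [comm|[x ->] a]; last first.
  apply/lfunP => w; rewrite !comp_lfunE /salg_rep !sum_lfunE linear_sum.
  apply: eq_bigr => p _; rewrite !scale_lfunE linearZ /=.
  by rewrite -!comp_lfunE actions_commute.
apply: (triangular_span IS_ge_refl IS_ge_anti IS_ge_trans
  (pattern := IS_pattern)).
- by move=> q p i l; apply: entry_IS_pattern.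
- exact: entry_IS_no_pattern.
- exact: commutant_DIS_support.
- exact: commutant_DIS_constant.
Qed.

(** * Faithfulness *)

(** The entries at pairs of constant words already recover the partial map. *)
Lemma IS_act_inj : (0 < k)%N -> injective rho.
Proof.
move=> k_gt0 p q pq; apply/val_inj/ffunP => u /=.
have eq_const v : (p u == Some v) = (q u == Some v).
  have E (r : IS n) : IS_rel r [ffun=> u] [ffun=> v] = (r u == Some v).
    apply/IS_relP/eqP => [/(_ (Ordinal k_gt0))|ruv j]; by rewrite !ffunE.
  have := congr1 (fun g => entry g [ffun=> u] [ffun=> v]) pq.
  rewrite !entry_IS_act !E.
  by do 2!case: eqP => _ //; move=> /eqP; rewrite ?oner_eq0 // eq_sym oner_eq0.
case pu: (p u) => [v|].
  by apply/esym/eqP; rewrite -eq_const pu.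
case qu: (q u) => [v|//].
by have := eq_const v; rewrite pu qu eqxx.
Qed.

(** Colouring each block by a point [j] of its upper row takes at most [k]
    letters. *)
Lemma DIS_pattern_exists b : (k <= n)%N -> exists i l, DIS_pattern b i l.
Proof.
move=> kn.
have rep x : exists j, inl j \in pblock b x.
  have [B [Bb xB [j jB] _]] := block_of b x; exists j.
  have /andP[/and3P[_ trivb _] _] := blocksP b.
  by rewrite (def_pblock trivb Bb xB).
pose c x : 'I_k := xchoose (rep x).
have cP x : inl (c x) \in pblock b x by apply: xchooseP (rep x).
have cE x y : pblock b x = pblock b y -> c x = c y.
  by move=> xy; apply: eq_xchoose => j; rewrite xy.
pose d x : 'I_n := widen_ord kn (c x).
exists [ffun j => d (inl j)], [ffun j => d (inr j)].
have dE : glue_lab [ffun j => d (inl j)] [ffun j => d (inr j)] =1 d.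
  by case=> j /=; rewrite ffunE.
apply/same_kernelP => x y; rewrite !dE; apply/eqP/eqP => [/cE|dxy].
  by rewrite /d => ->.
have cxy : c x = c y by apply/val_inj; apply: (congr1 val dxy).
have := cP x; rewrite pblock_DIS => /eqP ->; rewrite cxy.
by have := cP y; rewrite pblock_DIS => /eqP ->.
Qed.

Lemma identity_kernel : exists b, same_kernel (pblock b) (glue_lab (@id 'I_k) id).
Proof. by apply: crossing_kernel; split=> j; exists j. Qed.

Lemma salg_rep_DIS_inj :
  injective (salg_rep sigma) <-> (k <= n)%N.
Proof.
split=> [inj|kn x y xy].
  rewrite leqNgt; apply/negP => nk.
  have [b bE] := identity_kernel.
  (* A word [i] with this pattern would have [k > n] distinct letters. *)
  have [i l|x [x1 x0]] := triangular_relation (@DIS_le_refl k) (@DIS_le_anti k)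
      (@DIS_le_trans k) (pattern := DIS_pattern) entry_DIS_pattern
      entry_DIS_no_pattern (s := b).
    apply/negP => bil; have : injective i.
      move=> u v iuv; have /same_kernelP/(_ (inl u) (inl v)) := bE.
      have /same_kernelP -> := bil; rewrite /= iuv eqxx => /esym/eqP; exact.
    by move/leq_card; rewrite !card_ord leqNgt nk.
  have {}x0 : x = 0 by apply: inj; rewrite x0 linear0.
  move: x1; rewrite big1 => [/eqP|a _]; first by rewrite eq_sym oner_eq0.
  by rewrite x0 ffunE.
apply/eqP; rewrite -subr_eq0; apply/eqP/ffunP => b; rewrite [RHS]ffunE.
have z0 : salg_rep sigma (x - y) = 0 by rewrite linearB /= xy subrr.
apply: (downset_sums_eq0 (@DIS_le_refl k) (@DIS_le_anti k) (@DIS_le_trans k)) => {}b.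
have [i [l bil]] := DIS_pattern_exists b kn.
rewrite -(salg_rep_pattern entry_DIS_pattern _ bil) z0.
by rewrite /entry lfunE /= ffunE.
Qed.

(** Two letters already separate the partitions, since a partition is determined
    by the two-valued colourings compatible with it; with a single letter every
    partition acts as the identity. *)
Lemma DIS_act_inj :
  (0 < n)%N -> (0 < k)%N ->
  (injective sigma <-> (2 <= n)%N \/ k = 1%N).
Proof.
move=> n_gt0 k_gt0; split=> [inj|].
  have [n_gt1|n_le1] := ltnP 1 n; first by left.
  have n1 : n = 1%N by apply/eqP; rewrite eqn_leq n_le1.
  right; apply/eqP; rewrite eqn_leq k_gt0 andbT leqNgt; apply/negP => k_gt1.
  have [a aE] := identity_kernel.
  have [|b bE] := @crossing_kernel k _ (fun=> tt).
    by split=> j; exists j.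
  have ab : a = b.
    apply: inj; apply: entry_ext => i l; rewrite !entry_DIS_act.
    have triv (c : DIS k) : compatible c (glue_lab i l).
      apply/compatible_pblock => x y _; apply/val_inj => /=.
      have lt1 (u : 'I_n) : val u = 0%N by case: u => u /=; rewrite n1; case: u.
      by rewrite !lt1.
    by rewrite /DIS_rel !triv.
  have /same_kernelP/(_ (inl (Ordinal k_gt0)) (inl (Ordinal k_gt1))) := aE.
  by have /same_kernelP := bE; rewrite ab => ->.
case=> [n_gt1|k1] a b ab.
  pose e (t : bool) : 'I_n := if t then Ordinal n_gt1 else Ordinal n_gt0.
  have e_inj : injective e by case=> [] [].
  apply: dis_ext => f g.
  have ker : same_kernel (glue_lab f g)
      (glue_lab [ffun j => e (f j)] [ffun j => e (g j)]).
    have E : glue_lab [ffun j => e (f j)] [ffun j => e (g j)] =1 e \o glue_lab f g.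
      by case=> j /=; rewrite ffunE.
    by apply/same_kernelP => x y; rewrite !E /= (inj_eq e_inj).
  rewrite !(compatible_same_kernel _ ker).
  have := congr1 (fun h => entry h [ffun j => e (f j)] [ffun j => e (g j)]) ab.
  rewrite !entry_DIS_act.
  rewrite /DIS_rel; do 2!case: compatible => //; move=> /eqP;
    by rewrite ?oner_eq0 // eq_sym oner_eq0.
have inj : injective (salg_rep sigma).
  by apply/salg_rep_DIS_inj; rewrite k1.
have /ffunP/(_ a) : salg_basis F a = salg_basis F b.
  by apply: inj; rewrite !salg_rep_basis.
by rewrite !ffunE eqxx; case: eqP => // _ /eqP; rewrite oner_eq0.
Qed.

(** A word of length [k >= n] can list all letters of the domain of [q]; the
    unused positions repeat one of them, which exists because [q] is nonempty. *)
Lemma IS_pattern_exists_nonempty q : (n <= k)%N -> q != is_empty n ->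
  exists i l, IS_pattern q i l.
Proof.
move=> nk q_ne.
have /existsP[u0 u0P] : [exists u, q u != None].
  apply: contraNT q_ne; rewrite negb_exists => /forallP q0.
  by apply/eqP/val_inj/ffunP => u; rewrite /= ffunE; apply/eqP; rewrite -[_ == _]negbK.
pose i : word := [ffun j : 'I_k => if insub (val j) is Some u
                   then if q u != None then u else u0 else u0].
have iP j : q (i j) != None.
  by rewrite ffunE; case: insub => // u; case: ifP.
have [l il] : exists l, IS_rel q i l.
  exists [ffun j => odflt u0 (q (i j))]; apply/IS_relP => j; rewrite [in RHS]ffunE.
  by have := iP j; case: (q (i j)).
exists i, l; apply/IS_patternP; split=> // u qu.
exists (widen_ord nk u); rewrite ffunE /= valK qu //.
Qed.

Lemma contracted_rep_IS_inj : (0 < n)%N -> (0 < k)%N ->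
  injective (@contracted_rep F (IS n) (tpow F n k) (is_empty n) rho)
    <-> (n <= k)%N.
Proof.
move=> n_gt0 k_gt0; split=> [inj|nk x y].
  rewrite leqNgt; apply/negP => kn.
  have id_inj : partial_inj [ffun u : 'I_n => Some u].
    apply/forallP => u; apply/forallP => v; rewrite !ffunE.
    by apply/implyP => /andP[/eqP[->]].
  pose one : IS n := MkIS id_inj.
  (* A word with this pattern would list [n > k] letters. *)
  have [i l|x [x1 x0]] := triangular_relation IS_ge_refl IS_ge_anti IS_ge_trans
      (pattern := IS_pattern) entry_IS_pattern entry_IS_no_pattern (s := one).
    apply/negP => /IS_patternP[_ dom].
    have sub : (#|'I_n| <= #|codom i|)%N.
      apply/subset_leq_card/subsetP => u _; have [|j <-] := dom u; last exact: codom_f.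
      by rewrite ffunE.
    by have := leq_trans sub (leq_image_card i predT); rewrite !card_ord leqNgt kn.
  have : x - 0 \in <[salg_basis F (is_empty n)]>%VS.
    rewrite (Quotient.idealrBE); apply/eqP; apply: inj.
    by rewrite !contracted_repE ?IS_act_empty // x0 linear0.
  rewrite subr0 => /vlineP[c xE].
  move: x1; rewrite (big_pred1 one) => [|p /=]; last first.
    apply/IS_leP/eqP => [h|->//]; apply/val_inj/ffunP => u /=.
    by rewrite ffunE; apply: h; rewrite ffunE.
  rewrite xE !ffunE; case: eqP => [/(congr1 (fun p : IS n => p (Ordinal n_gt0)))|_].
    by rewrite /= !ffunE.
  by rewrite [LHS]mulr0 => /eqP; rewrite eq_sym oner_eq0.
rewrite /contracted_rep => xy.
rewrite -[x]reprK -[y]reprK; apply/eqP; rewrite -Quotient.idealrBE.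
set z := repr x - repr y.
have z0 : salg_rep rho z = 0 by rewrite linearB /= xy subrr.
(* Only the sum over all elements, attached to the empty map, is not seen by the
   operator; subtracting [s] times the empty map makes it vanish too. *)
pose s := \sum_p z p.
suff -> : z = s *: salg_basis F (is_empty n) by rewrite memvZ ?memv_line.
apply/eqP; rewrite -subr_eq0; apply/eqP/ffunP => q; rewrite [RHS]ffunE.
apply: (downset_sums_eq0 IS_ge_refl IS_ge_anti IS_ge_trans) => {}q.
have zE p : (z - s *: salg_basis F (is_empty n)) p = z p - s * (p == is_empty n)%:R.
  by rewrite !ffunE.
rewrite (eq_bigr _ (fun p _ => zE p)).
have [->|q_ne] := eqVneq q (is_empty n).
  rewrite (eq_bigl predT) => [|p]; last by apply/IS_leP => u v; rewrite is_emptyE.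
  rewrite big_split /= sumrN -mulr_sumr.
  rewrite [X in _ * X](bigD1 (is_empty n)) //= eqxx.
  by rewrite [X in _ * (_ + X)]big1 => [|p /negPf ->] //; rewrite addr0 mulr1 subrr.
have [i [l qil]] := IS_pattern_exists_nonempty nk q_ne.
have := salg_rep_pattern entry_IS_pattern z qil.
rewrite z0 /entry lfunE /= ffunE => sum0; rewrite [RHS]sum0; apply: eq_bigr => p qp.
case: eqP => [pE|_]; last by rewrite mulr0 subr0.
case/eqP: q_ne; apply: IS_le_anti; rewrite -{1}pE -/(IS_ge p q) qp.
by apply/IS_leP => u v; rewrite is_emptyE.
Qed.

End SchurWeyl.

Theorem theorem1 (R : realType) (n k : nat) (hn : (0 < n)%N) (hk : (0 < k)%N) :
  let rho : IS n -> 'End(tpow R[i] n k) := @IS_act R[i] n k in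
  let sigma : DIS k -> 'End(tpow R[i] n k) := @DIS_act R[i] n k in
  (forall (p : IS n) (a : DIS k), (rho p \o sigma a = sigma a \o rho p)%VF) /\
  (forall f : 'End(tpow R[i] n k),
     commutant rho f <-> exists x : salg R[i] (DIS k), f = salg_rep sigma x) /\
  (forall f : 'End(tpow R[i] n k),
     commutant sigma f <-> exists x : salg R[i] (IS n), f = salg_rep rho x) /\
  injective rho /\
  (injective sigma <-> (2 <= n)%N \/ k = 1%N) /\
  (injective (@contracted_rep R[i] (IS n) (tpow R[i] n k) (is_empty n) rho)
     <-> (n <= k)%N) /\
  (injective (salg_rep sigma) <-> (k <= n)%N).
Proof.
move=> rho sigma; split; first exact: actions_commute.
split; first exact: commutant_IS.
split; first exact: commutant_DIS.
split; first exact: IS_act_inj.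
split; first exact: DIS_act_inj.
split; first exact: contracted_rep_IS_inj.
exact: salg_rep_DIS_inj.
Qed.
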